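(* Let $v_1,\dots,v_m\in\mathbb{R}^n$ and let $a_1\le b_1,\dots,a_m\le b_m$ be real numbers. Then a vector $w\in\mathbb{R}^n$ can be written as $w=\sum_{i=1}^m x_iv_i$ for some real numbers $a_1\le x_1\le b_1,\dots,a_m\le x_m\le b_m$ if and only if $w\in\sum_{i=1}^m\mathbb{R}v_i$ and $$(u,w)\le \sum_{i=1}^m a_i\frac{(u,v_i)-|(u,v_i)|}{2}+\sum_{i=1}^m b_i\frac{(u,v_i)+|(u,v_i)|}{2}$$ for every $\{v_1,\dots,v_m\}$-indecomposable point $[u]\in\mathbb{RP}^{n-1}_+$ (i.e. for every representative $u$ of such a point; the inequality is invariant under positive scaling of $u$).
   Context: $(u,v)$ is the standard inner product. $\mathbb{RP}^{n-1}_+$ is the set of equivalence classes of $\mathbb{R}^n\setminus\{0\}$ under $v\sim v'$ iff $v'=rv$ for some real $r>0$; the class of $v$ is $[v]$. Let $W=\sum_{i=1}^m\mathbb{R}v_i$. A nonzero $u\in W$ is $\{v_1,\dots,v_m\}$-decomposable if there exist nonzero $u',u''\in W$ with $u=u'+u''$, $[u']\ne[u]$, $[u'']\ne[u]$, and $(u',v)(u'',v)\ge0$ for every $v\in\{v_1,\dots,v_m\}$; otherwise it is $\{v_1,\dots,v_m\}$-indecomposable. A point of $\mathbb{RP}^{n-1}_+$ is $\{v_1,\dots,v_m\}$-indecomposable if it equals $[u]$ for some $\{v_1,\dots,v_m\}$-indecomposable $u\in W$. *)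

(* Defs.v *)
From HB Require Import structures.
From mathcomp Require Import all_boot all_order all_algebra.
From mathcomp Require Import boolp classical_sets reals.

Set Implicit Arguments.
Unset Strict Implicit.
Unset Printing Implicit Defensive.

Import Order.TTheory GRing.Theory Num.Theory.
Local Open Scope classical_set_scope.
Local Open Scope ring_scope.

Definition dot (R : realType) (n : nat) (u v : 'rV[R]_n) : R :=
  \sum_j u 0 j * v 0 j.

Definition pos_equiv (R : realType) (n : nat) (v v' : 'rV[R]_n) : Prop :=
  exists r : R, 0 < r /\ v' = r *: v.

(* The class [v] in (R^n \ {0}) / pos_equiv, as a subset of R^n; it is only
   meaningful for v != 0. *)
Definition pos_class (R : realType) (n : nat) (v : 'rV[R]_n) : set 'rV[R]_n :=
  [set v' | v' != 0 /\ pos_equiv v v'].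

(* RP^{n-1}_+, indexed by the dimension n of the ambient space. *)
Definition RPplus (R : realType) (n : nat) : set (set 'rV[R]_n) :=
  [set p | exists v : 'rV[R]_n, v != 0 /\ p = pos_class v].

Definition span_of (R : realType) (n m : nat) (v : 'I_m -> 'rV[R]_n) :
    {vspace 'rV[R]_n} :=
  (\sum_(i < m) <[v i]>)%VS.

(* Only used for nonzero u in span_of v. *)
Definition decomposable (R : realType) (n m : nat) (v : 'I_m -> 'rV[R]_n)
    (u : 'rV[R]_n) : Prop :=
  exists u' u'' : 'rV[R]_n,
    [/\ u' \in span_of v /\ u' != 0,
        u'' \in span_of v /\ u'' != 0,
        u = u' + u'',
        pos_class u' <> pos_class u /\ pos_class u'' <> pos_class u
      & forall i : 'I_m, 0 <= dot u' (v i) * dot u'' (v i)].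

Definition indecomposable (R : realType) (n m : nat) (v : 'I_m -> 'rV[R]_n)
    (u : 'rV[R]_n) : Prop :=
  [/\ u \in span_of v, u != 0 & ~ decomposable v u].

Definition indecomposable_point (R : realType) (n m : nat)
    (v : 'I_m -> 'rV[R]_n) (p : set 'rV[R]_n) : Prop :=
  RPplus p /\
  exists u : 'rV[R]_n, indecomposable v u /\ p = pos_class u.

(* Main.v *)
(* The right-hand side is the support function h of the zonotope
   Z = { \sum x_i v_i | a_i <= x_i <= b_i }.  If w is in W but not in Z, the
   vector from the point of Z closest to w to w itself violates the inequality,
   so w is in Z as soon as it holds for every nonzero u in W.  It is enough
   to test indecomposable u: h is additive on sums u = y + z such that
   (y, v_i) and (z, v_i) never have opposite signs, and a decomposable u is such
   a sum in which y and z each vanish on more of the v_i than u does. *)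
Require Import Defs.
From mathcomp Require Import all_boot all_order all_algebra.
From mathcomp Require Import boolp classical_sets reals.
From mathcomp Require Import topology normedtype derive.
From mathcomp Require Import ring lra.

Import Order.TTheory GRing.Theory Num.Theory.
Import numFieldNormedType.Exports.
Local Open Scope classical_set_scope.
Local Open Scope ring_scope.

Set Implicit Arguments.
Unset Strict Implicit.
Unset Printing Implicit Defensive.

(** * Bilinearity and definiteness of the inner product *)

Section DotProduct.
Variables (R : realType) (n : nat).
Implicit Types u v w : 'rV[R]_n.

Lemma dotC u w : dot u w = dot w u.
Proof. by apply: eq_bigr => j _; rewrite mulrC. Qed.

Lemma dotDl u v w : dot (u + v) w = dot u w + dot v w.
Proof. by rewrite -big_split; apply: eq_bigr => j _; rewrite mxE mulrDl. Qed.

Lemma dotZl (c : R) u w : dot (c *: u) w = c * dot u w.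
Proof. by rewrite /dot mulr_sumr; apply: eq_bigr => j _; rewrite mxE mulrA. Qed.

Lemma dotBl u v w : dot (u - v) w = dot u w - dot v w.
Proof. by rewrite -scaleN1r dotDl dotZl mulN1r. Qed.

Lemma dot0l w : dot 0 w = 0.
Proof. by rewrite -(scale0r w) dotZl mul0r. Qed.

Lemma dotBr u v w : dot u (v - w) = dot u v - dot u w.
Proof. by rewrite dotC dotBl !(dotC u). Qed.

Lemma dotZr (c : R) u w : dot u (c *: w) = c * dot u w.
Proof. by rewrite dotC dotZl dotC. Qed.

Lemma dot_sumr (m : nat) (F : 'I_m -> 'rV[R]_n) u :
  dot u (\sum_i F i) = \sum_i dot u (F i).
Proof.
rewrite /dot exchange_big; apply: eq_bigr => j _.
by rewrite summxE mulr_sumr.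
Qed.

Lemma dot_self_ge0 u : 0 <= dot u u.
Proof. by apply: sumr_ge0 => j _; rewrite -expr2 sqr_ge0. Qed.

Lemma dot_self_eq0 u : dot u u = 0 -> u = 0.
Proof.
move/eqP; rewrite psumr_eq0 => [/allP u0|j _]; last by rewrite -expr2 sqr_ge0.
apply/rowP => j; rewrite mxE; apply/eqP.
by have := u0 j (mem_index_enum j); rewrite mulf_eq0 orbb.
Qed.

End DotProduct.

(** * Splitting decomposable vectors into pieces of smaller support *)

Section Zonotope.
Variables (R : realType) (n m : nat) (v : 'I_m -> 'rV[R]_n).
Implicit Types u w y z : 'rV[R]_n.

Lemma span_ofP w :
  reflect (exists x : 'I_m -> R, w = \sum_i x i *: v i) (w \in span_of v).
Proof.
apply: (iffP idP) => [/memv_sumP[f fv ->]|[x ->]]; last first.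
  apply: memv_sumr => i _.
  exact/rpredZ/memv_line.
have [x xP] := choice (fun i => vlineP _ _ (fv i isT)).
by exists x; apply: eq_bigr => i _; rewrite -xP.
Qed.

(** Expanding one factor of [dot u u] along the [v i] gives [dot u u = 0]. *)
Lemma span_of_dot_eq0 u :
  u \in span_of v -> (forall i, dot u (v i) = 0) -> u = 0.
Proof.
move=> /span_ofP[x ux] u0; apply: dot_self_eq0.
rewrite [X in dot _ X]ux dot_sumr big1 // => i _.
by rewrite dotZr u0 mulr0.
Qed.

Definition dot_supp u : {set 'I_m} := [set i | dot u (v i) != 0].

Lemma pos_class_scale u (c : R) : 0 < c -> pos_class (c *: u) = pos_class u.
Proof.
move=> c0; apply/seteqP; split=> y [y0 [r [r0 yE]]]; split=> //; rewrite yE.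
- by exists (r * c); split; [exact: mulr_gt0 | exact: scalerA].
- by exists (r / c); split; [exact: divr_gt0 | rewrite scalerA divfK // gt_eqF].
Qed.

(* Subtract from [f] the largest multiple of [g] keeping the signs of [g]. *)
Lemma sign_preserving_elimination (I : finType) (f g : I -> R) i1 :
  g i1 != 0 -> (forall i, 0 <= f i * g i) ->
  exists t i0, [/\ 0 <= t, g i0 != 0, f i0 = t * g i0 &
                   forall i, 0 <= (f i - t * g i) * g i].
Proof.
(* The critical multiple is the least ratio [f i / g i] over the support of [g]. *)
move=> g1 fg; pose r i := f i / g i.
have [i0 gi0 rmin] := arg_minP (P := fun i => g i != 0) r g1.
have rg i : g i != 0 -> f i = r i * g i by move=> gi; rewrite /r divfK.
have g2 i : g i != 0 -> 0 < g i * g i.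
  by move=> gi; rewrite -expr2 exprn_even_gt0.
exists (r i0), i0; split => //.
- have := fg i0; rewrite rg // -mulrA pmulr_lge0 //; exact: g2.
- exact: rg.
- move=> i; have [->|gi] := eqVneq (g i) 0; first by rewrite mulr0.
  rewrite {1}(rg i gi) -mulrBl -mulrA pmulr_lge0 ?g2 // subr_ge0.
  exact: rmin.
Qed.

(** Two eliminations: removing a multiple of [u] from [u'] leaves [y], which vanishes at some [i0]
    in the support of [u]; removing [t *: y] from [u] leaves [z], which vanishes at some [i3] in the
    support of [y]. The pieces are [t *: y] and [z]. *)
Lemma decomposable_dot_supp u :
  u \in span_of v -> u != 0 -> decomposable v u ->
  exists y z, [/\ y \in span_of v /\ y != 0, z \in span_of v /\ z != 0,
    u = y + z, dot_supp y \proper dot_supp u /\ dot_supp z \proper dot_supp u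
    & forall i, 0 <= dot y (v i) * dot z (v i)].
Proof.
move=> uW u0 [u' [u'' [[u'W u'0] [u''W u''0] uE [ncl _] sgn]]].
have uEi i : dot u (v i) = dot u' (v i) + dot u'' (v i) by rewrite uE dotDl.
have supp_neq0 y : y \in span_of v -> y != 0 -> exists i, dot y (v i) != 0.
  move=> yW y0; apply: contrapT => no; move/eqP: y0; apply.
  apply: span_of_dot_eq0 => // i; apply: contrapT => /eqP yi.
  by apply: no; exists i.
have u'u i : 0 <= dot u' (v i) * dot u (v i).
  by rewrite uEi mulrDr addr_ge0 // -expr2 sqr_ge0.
have u'supp i : dot u (v i) = 0 -> dot u' (v i) = 0.
  by have := sgn i; rewrite uEi => *; nra.
have [i1 ui1] := supp_neq0 u uW u0.
have [s [i0 [s0 ui0 u'i0 ysgn]]] := sign_preserving_elimination ui1 u'u.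
pose y := u' - s *: u.
have yE i : dot y (v i) = dot u' (v i) - s * dot u (v i).
  by rewrite dotBl dotZl.
have yW : y \in span_of v by rewrite rpredB // rpredZ.
have y0 : y != 0.
  (* Otherwise [u' = s *: u], with [s > 0] because [u' != 0], so both have the same class. *)
  apply/eqP => /eqP; rewrite subr_eq0 => /eqP u's; apply: ncl.
  rewrite u's pos_class_scale // lt_neqAle s0 andbT eq_sym.
  by apply: contra_neq u'0 => sE; rewrite u's sE scale0r.
have yi0 : dot y (v i0) = 0 by rewrite yE u'i0 subrr.
have ysupp i : dot u (v i) = 0 -> dot y (v i) = 0.
  by move=> ui; rewrite yE ui u'supp // mulr0 subrr.
have uy i : 0 <= dot u (v i) * dot y (v i) by rewrite yE mulrC.
have [i2 yi2] := supp_neq0 y yW y0.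
have [t [i3 [t0 yi3 ui3 zsgn]]] := sign_preserving_elimination yi2 uy.
pose z := u - t *: y.
have zE i : dot z (v i) = dot u (v i) - t * dot y (v i).
  by rewrite dotBl dotZl.
have ui3n : dot u (v i3) != 0 by apply: contra_neq yi3; exact: ysupp.
have tn0 : t != 0 by apply: contra_neq ui3n => tE; rewrite ui3 tE mul0r.
exists (t *: y), z; split.
- by rewrite rpredZ // scaler_eq0 negb_or tn0.
- split; first by rewrite rpredB // rpredZ.
  (* At [i0], where [y] vanishes, [z] takes the nonzero value of [u]. *)
  apply: contra_neq ui0 => z0; have := zE i0.
  by rewrite z0 dot0l yi0 mulr0 subr0.
- by rewrite addrC subrK.
- split; apply/properP; split.
  + apply/fintype.subsetP => i; rewrite !inE dotZl.
    by apply: contra_neq => /ysupp->; rewrite mulr0.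
  + by exists i0; rewrite !inE // dotZl yi0 mulr0 eqxx.
  + apply/fintype.subsetP => i; rewrite !inE zE; apply: contra_neq => ui.
    by rewrite ysupp // ui mulr0 subrr.
  + by exists i3; rewrite !inE // zE ui3 subrr eqxx.
- by move=> i; rewrite dotZl -mulrA mulr_ge0 // mulrC zE.
Qed.

(** * The support function of the zonotope *)

Variables (a b : 'I_m -> R).
Hypothesis hab : forall i, a i <= b i.

(** The two quotients are [min(s, 0)] and [max(s, 0)] for [s = dot u (v i)]. *)
Definition zonotope_support u : R :=
  \sum_(i < m) a i * ((dot u (v i) - `|dot u (v i)|) / 2)
  + \sum_(i < m) b i * ((dot u (v i) + `|dot u (v i)|) / 2).

Lemma normr_same_sign (s t : R) : 0 <= s * t -> `|s + t| = `|s| + `|t|.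
Proof.
move=> st; apply/eqP; rewrite -(@eqrXn2 _ 2) ?addr_ge0 //.
by rewrite !sqrrD -normrM (ger0_norm st) !real_normK ?num_real // sqrrD.
Qed.

Lemma zonotope_supportD y z :
  (forall i, 0 <= dot y (v i) * dot z (v i)) ->
  zonotope_support (y + z) = zonotope_support y + zonotope_support z.
Proof.
move=> yz; rewrite /zonotope_support -!big_split; apply: eq_bigr => i _ /=.
by rewrite dotDl (normr_same_sign (yz i)); field.
Qed.

(** A linear form is maximised over a box one coordinate at a time, at the endpoint chosen by the
    sign of its coefficient. *)
Lemma zonotope_support_attained u
    (t := fun i => if 0 <= dot u (v i) then b i else a i) :
  dot u (\sum_i t i *: v i) = zonotope_support u.
Proof.
rewrite dot_sumr /zonotope_support -big_split; apply: eq_bigr => i _ /=.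
by rewrite dotZr /t; case: ger0P => s0; field.
Qed.

Lemma dot_le_zonotope_support u (x : 'I_m -> R) :
  (forall i, a i <= x i <= b i) ->
  dot u (\sum_i x i *: v i) <= zonotope_support u.
Proof.
move=> xab; rewrite -zonotope_support_attained !dot_sumr.
apply: ler_sum => i _; rewrite !dotZr; have /andP[ax xb] := xab i.
by case: ifPn => s0; [rewrite ler_wpM2r | rewrite ler_wnM2r // ltW // ltNge].
Qed.

(** * Separation by the closest point *)

Lemma closest_zonotope_point w :
  exists x : 'I_m -> R, (forall i, a i <= x i <= b i) /\
    forall x' : 'I_m -> R, (forall i, a i <= x' i <= b i) ->
      let d c := w - \sum_i c i *: v i in dot (d x) (d x) <= dot (d x') (d x').
Proof.
(* Coefficients are packed into a row vector, so that the box [A] is compact and the continuous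
   squared distance attains its minimum on it. *)
pose d (c : 'rV[R]_m) := w - \sum_i c 0 i *: v i.
pose A := [set c : 'rV[R]_m | forall i, `[a i, b i]%classic (c ord0 i)].
have Acpt : compact A.
  by apply: (@rV_compact R m (fun i => `[a i, b i]%classic)) => i;
    exact: segment_compact.
have A0 : A !=set0.
  by exists (\row_i a i) => i /=; rewrite mxE in_itv /= lexx hab.
have dE c j : d c 0 j = w 0 j - \sum_i c 0 i * v i 0 j.
  by rewrite !mxE summxE; congr (_ - _); apply: eq_bigr => i _; rewrite mxE.
have dcont j : continuous (fun c => d c 0 j).
  under [fun _ => _]eq_fun do rewrite dE.
  move=> c; apply: continuousB; first exact: cst_continuous.
  apply: continuous_big => [|i _]; first exact: add_continuous.
  move=> y; apply: continuousM; last exact: cst_continuous.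
  exact: coord_continuous.
have fcont : continuous (fun c => dot (d c) (d c)).
  apply: continuous_big => [|j _]; first exact: add_continuous.
  by move=> c; apply: continuousM; exact: dcont.
have [c cA cmin] := EVT_min_rV A0 Acpt (continuous_subspaceT fcont).
exists (c 0); split => [i|x' x'ab /=].
  by move: cA; rewrite inE => /(_ i) /=; rewrite in_itv.
have -> : \sum_i x' i *: v i = \sum_i (\row_i x' i) 0 i *: v i.
  by apply: eq_bigr => i _; rewrite mxE.
by apply: cmin; rewrite inE => i /=; rewrite mxE in_itv; exact: x'ab.
Qed.

(** If [u = w - z] is nonzero for the closest point [z], the point [y] maximising [dot u] satisfies
    [dot u y >= dot u w > dot u z]; a step from [z] towards [y] then gets closer to [w], a
    contradiction. *)
Lemma zonotope_separation w : w \in span_of v ->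
  (forall u, u \in span_of v -> u != 0 -> dot u w <= zonotope_support u) ->
  exists x : 'I_m -> R,
    (forall i, a i <= x i <= b i) /\ w = \sum_i x i *: v i.
Proof.
move=> wW wle; have [x [xab xmin]] := closest_zonotope_point w.
exists x; split => //; apply/eqP; rewrite -subr_eq0.
set z := \sum_i _; have [u uE] : exists u, u = w - z by exists (w - z).
rewrite -uE; apply/negP => /negP u0.
have uW : u \in span_of v by rewrite uE rpredB //; apply/span_ofP; exists x.
pose t i := if 0 <= dot u (v i) then b i else a i.
pose y := \sum_i t i *: v i.
have tab i : a i <= t i <= b i.
  by rewrite /t; case: ifP; rewrite lexx hab.
have uu : 0 < dot u u.
  by rewrite lt_def dot_self_ge0 andbT; apply: contra_neq u0 => /dot_self_eq0.
have uw : dot u w <= dot u y.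
  by rewrite zonotope_support_attained; exact: wle.
have [p pE] : exists p, p = y - z by exists (y - z).
have up : 0 < dot u p.
  have uuE : dot u u = dot u w - dot u z by rewrite -dotBr -uE.
  by rewrite pE dotBr subr_gt0 (lt_le_trans _ uw) // -subr_gt0 -uuE.
(* With [P = dot u p] and [Q = dot p p], moving by [e *: p] changes the squared distance by
   [-2eP + e^2 Q]. This [e] lies in [(0, 1]] and gives [eQ = P - eP], so the change is
   [-eP(1 + e) < 0]. *)
pose e := dot u p / (dot u p + dot p p).
have pp := dot_self_ge0 p.
have e0 : 0 < e by rewrite divr_gt0 // ltr_pwDl.
have e1 : e <= 1 by rewrite ler_pdivrMr ?mul1r ?lerDl // ltr_pwDl.
have eE : e * dot u p + e * dot p p = dot u p.
  by rewrite -mulrDr /e divfK // gt_eqF // ltr_pwDl.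
(* The new coefficients are convex combinations of [x] and [t], so they stay in the box. *)
have /xmin /= : forall i, a i <= x i + e * (t i - x i) <= b i.
  move=> i; have := xab i; have := tab i => /andP[? ?] /andP[? ?].
  by apply/andP; split; nra.
have -> : \sum_i (x i + e * (t i - x i)) *: v i = z + e *: p.
  rewrite pE scalerBr !scaler_sumr -sumrB -big_split; apply: eq_bigr => i _ /=.
  by rewrite scalerDl -scalerA scalerBl scalerBr.
rewrite -/z opprD addrA -!uE !(dotBl, dotBr, dotZl, dotZr) (dotC p u).
move: (dot u u) (dot u p) (dot p p) e e0 e1 eE up pp {uu uw} => U P Q e; nra.
Qed.

(** Strong induction on [#|dot_supp u|], which drops for both pieces of a decomposable [u]; the two
    inequalities for the pieces add up. *)
Lemma dot_le_zonotope_support_indecomposable w :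
  (forall u, indecomposable v u -> dot u w <= zonotope_support u) ->
  forall u, u \in span_of v -> u != 0 -> dot u w <= zonotope_support u.
Proof.
move=> wle u; have [k] := ubnP #|dot_supp u|; elim: k u => // k IH u.
rewrite ltnS => uk uW u0.
have [/(decomposable_dot_supp uW u0)|nd] := pselect (decomposable v u);
  last exact: wle.
move=> [y [z [[yW y0] [zW z0] uE [yu zu] yz]]].
rewrite uE zonotope_supportD // dotDl lerD // IH //.
- exact: leq_trans (proper_card yu) uk.
- exact: leq_trans (proper_card zu) uk.
Qed.

End Zonotope.

Unset Implicit Arguments.

Theorem theorem2p3 (R : realType) (n m : nat) (v : 'I_m -> 'rV[R]_n)
    (a b : 'I_m -> R) (hab : forall i, a i <= b i) (w : 'rV[R]_n) :
  (exists x : 'I_m -> R,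
     (forall i, a i <= x i <= b i) /\ w = \sum_(i < m) x i *: v i)
  <->
  (w \in span_of v /\
   forall p : set 'rV[R]_n, indecomposable_point v p ->
   forall u : 'rV[R]_n, p u ->
     dot u w <=
       \sum_(i < m) a i * ((dot u (v i) - `|dot u (v i)|) / 2)
     + \sum_(i < m) b i * ((dot u (v i) + `|dot u (v i)|) / 2)).
Proof.
split=> [[x [xab ->]]|[wW wle]].
  split; first by apply/span_ofP; exists x.
  by move=> p _ u _; exact: dot_le_zonotope_support.
apply: zonotope_separation => //.
apply: dot_le_zonotope_support_indecomposable => u uind.
have [_ u0 _] := uind.
(* An indecomposable vector represents its own class, so the hypothesis on points applies to it. *)
have upt : indecomposable_point v (pos_class u).
  by split; exists u.
apply: (wle _ upt); split => //.
by exists 1; rewrite scale1r.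
Qed.
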